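(* Let $\mu$ be a computable non-atomic probability measure on the Cantor space $\Omega=\{0,1\}^{\mathbb{N}}$. Then for every constant $c$ there exists a sequence $\omega\in\Omega$ such that \[ \mathbf{d}^{\limsup A}_\mu(\omega) < \mathbf{d}^{A}_\mu(\omega) - \log\mathbf{d}^{A}_\mu(\omega) - c . \]
   Context: $\Omega$ is the set of infinite binary sequences; for a finite binary string $x$, $[x]$ denotes the set of sequences extending $x$; $\omega_{1\ldots n}$ is the length-$n$ prefix of $\omega$; $\mathbb{B}^*$ is the set of finite binary strings; $\log$ is binary logarithm. A measure $\mu$ on $\Omega$ is computable if there is an algorithm that, given a string $x$ and a rational $\varepsilon>0$, outputs an $\varepsilon$-approximation of $\mu([x])$. It is non-atomic if $\mu(\{\omega\})=0$ for every $\omega\in\Omega$. A function $f:\mathbb{B}^*\to[0,\infty)$ is lower semicomputable if it is the pointwise limit of a computable increasing sequence of finitely supported rational-valued functions. A continuous lower semicomputable semimeasure is a lower semicomputable $a:\mathbb{B}^*\to[0,\infty)$ with $\sum_{x\in S}a(x)\le 1$ for every prefix-free set $S\subseteq\mathbb{B}^*$. Fix a universal such semimeasure $\mathbf{a}$, i.e. one such that for every continuous lower semicomputable semimeasure $a$ there is a constant $C$ with $a(x)\le C\,\mathbf{a}(x)$ for all $x$ (such $\mathbf a$ exists). The a priori complexity is $KA(x)=-\log\mathbf{a}(x)$. Define $\mathbf{d}^{A}_\mu(\omega)=\sup_n\{-\log\mu([\omega_{1\ldots n}])-KA(\omega_{1\ldots n})\}$ and $\mathbf{d}^{\limsup A}_\mu(\omega)=\limsup_n\{-\log\mu([\omega_{1\ldots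 n}])-KA(\omega_{1\ldots n})\}$. *)

(* Defs.v *)
(* MathComp and MathComp-Analysis *)
From HB Require Import structures.
From mathcomp Require Import all_boot all_order all_algebra.
From mathcomp Require Import all_classical all_reals all_analysis.
Set Implicit Arguments.
Unset Strict Implicit.
Unset Printing Implicit Defensive.
Import Order.TTheory GRing.Theory Num.Theory.
Import numFieldNormedType.Exports.
Local Open Scope classical_set_scope.
Local Open Scope ring_scope.

(* Total recursive functions. Minimization is applied only to regular
   functions, so that no partial function is needed; by Kleene's normal form
   theorem this yields exactly the total Turing-computable functions. *)
Inductive recursive : forall n : nat, (n.-tuple nat -> nat) -> Prop :=
| rec_zero : recursive (fun _ : 0.-tuple nat => 0%N)
| rec_succ : recursive (fun v : 1.-tuple nat => (thead v).+1)
| rec_proj n (i : 'I_n) : recursive (fun v : n.-tuple nat => tnth v i)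
| rec_comp m n (f : m.-tuple nat -> nat) (g : 'I_m -> n.-tuple nat -> nat) :
    recursive f -> (forall i, recursive (g i)) ->
    recursive (fun v : n.-tuple nat => f [tuple g i v | i < m])
| rec_prim n (f : n.-tuple nat -> nat) (g : n.+2.-tuple nat -> nat) :
    recursive f -> recursive g ->
    recursive (fun v : n.+1.-tuple nat =>
      nat_rect (fun=> nat) (f (behead_tuple v))
        (fun k r => g [tuple of k :: r :: behead_tuple v]) (thead v))
| rec_min n (f : n.+1.-tuple nat -> nat)
    (f_regular : forall v : n.-tuple nat,
       exists y, f [tuple of y :: v] == 0%N) :
    recursive f -> recursive (fun v : n.-tuple nat => ex_minn (f_regular v)).

Definition recursive_rat n (f : n.-tuple nat -> rat) : Prop :=
  exists p q r : n.-tuple nat -> nat,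
    [/\ recursive p, recursive q, recursive r &
        forall v, f v = ((p v)%:R - (q v)%:R) / (r v).+1%:R].

(* Bijective base-2 numeration: a computable bijection between binary strings
   and natural numbers. *)
Fixpoint str_code (x : seq bool) : nat :=
  if x is b :: y then ((str_code y).*2 + b.+1)%N else 0%N.

(* A finitely supported function is given to an algorithm as a finite table;
   hence, besides the values, a bound on the support of [g n] has to be
   computed from [n]. *)
Definition computable_finsupp_seq (g : nat -> seq bool -> rat) : Prop :=
  (exists2 G : 2.-tuple nat -> rat, recursive_rat G &
     forall n x, g n x = G [tuple n; str_code x]) /\
  (exists2 s : 1.-tuple nat -> nat, recursive s &
     forall n x, (s [tuple n] < str_code x)%N -> g n x = 0).

Definition lower_semicomputable (R : realType) (f : seq bool -> R) : Prop :=
  exists g : nat -> seq bool -> rat,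
    [/\ computable_finsupp_seq g,
        forall n x, g n x <= g n.+1 x &
        forall x, (fun n => ratr (g n x) : R) @ \oo --> f x].

Definition prefix_free (S : set (seq bool)) : Prop :=
  forall x y, S x -> S y -> prefix x y -> x = y.

Definition lsc_semimeasure (R : realType) (a : seq bool -> R) : Prop :=
  [/\ forall x, 0 <= a x,
      lower_semicomputable a &
      forall S, prefix_free S -> (\esum_(x in S) (a x)%:E <= 1)%E].

Definition universal_semimeasure (R : realType) (a : seq bool -> R) : Prop :=
  lsc_semimeasure a /\
  forall b : seq bool -> R, lsc_semimeasure b ->
    exists C : R, forall x, b x <= C * a x.

Definition cylinder (x : seq bool) : set cantor_space :=
  [set w : cantor_space | mkseq w (size x) = x].

(* The cylinders generate the Borel sigma-algebra of the Cantor space. *)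
Notation Omega := (g_sigma_algebraType (range cylinder)).

(* The algorithm gets the string [x] and the rational number
   (p + 1) / (q + 1). *)
Definition computable_measure (R : realType) (mu : set Omega -> \bar R) :
    Prop :=
  exists2 F : 3.-tuple nat -> rat, recursive_rat F &
    forall (x : seq bool) (p q : nat),
      (`|mu (cylinder x) - (ratr (F [tuple str_code x; p; q]))%:E|
        <= (p.+1%:R / q.+1%:R)%:E)%E.

Definition non_atomic (R : realType) (mu : set Omega -> \bar R) : Prop :=
  forall w : Omega, mu [set w] = 0%E.

Definition log2 (R : realType) (x : R) : R := ln x / ln 2.

(* log2e 0 = -oo *)
Definition log2e (R : realType) (x : \bar R) : \bar R :=
  (lne x * ((ln 2)^-1)%:E)%E.

Definition KA (R : realType) (a : seq bool -> R) (x : seq bool) : \bar R :=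
  (- log2e (a x)%:E)%E.

(* A universal semimeasure is everywhere positive, so that [KA a x] is finite
   and the difference is never +oo - +oo. *)
Definition deficiency (R : realType) (mu : set Omega -> \bar R)
    (a : seq bool -> R) (w : Omega) (n : nat) : \bar R :=
  (- log2e (mu (cylinder (mkseq w n))) - KA a (mkseq w n))%E.

Definition dA (R : realType) (mu : set Omega -> \bar R)
    (a : seq bool -> R) (w : Omega) : \bar R :=
  ereal_sup (range (deficiency mu a w)).

Definition dlimsupA (R : realType) (mu : set Omega -> \bar R)
    (a : seq bool -> R) (w : Omega) : \bar R :=
  limn_esup (deficiency mu a w).

(* Main.v *)
(* Let p_0, p_1, ... be the prefixes of a computable branch, m_n = mu [p_n] and
   q_n the sibling of p_(n+1). The indicator function of {p_n} is a lower
   semicomputable semimeasure, so a(p_n) >= 1/C, and every sequence through q_n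
   has deficiency at least l_n = log (1 / (C m_n)). If the theorem failed, every
   such sequence would have later prefixes x with
   a(x) >= F_n mu[x], F_n = 2^(-c-1) 2^(l_n) / l_n, and finitely many disjoint
   such x cover [q_n]; hence a has mass at least F_n mu[q_n] below q_n. As long
   as m_n / m_(n+1) is bounded, which a greedy choice of the branch ensures,
   F_n mu[q_n] is at least a constant times ln l_(n+1) - ln l_n. By
   non-atomicity l_n tends to infinity, so the total mass of a would be
   infinite. *)
Require Import Defs.
From HB Require Import structures.
From mathcomp Require Import all_boot all_order all_algebra.
From mathcomp Require Import all_classical all_reals all_analysis.
From mathcomp Require Import zify ring lra.
Import Order.TTheory GRing.Theory Num.Theory.
Import numFieldNormedType.Exports.
Local Open Scope classical_set_scope.
Local Open Scope ring_scope.
Set Implicit Arguments.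
Unset Strict Implicit.

(** * Closure properties of the total recursive functions *)

Lemma eq_recursive n (f g : n.-tuple nat -> nat) :
  f =1 g -> recursive f -> recursive g.
Proof. by move=> /funext ->. Qed.

Lemma recursive_comp1 n (h : 1.-tuple nat -> nat) (f : n.-tuple nat -> nat) :
  recursive h -> recursive f -> recursive (fun v => h [tuple f v]).
Proof.
move=> hh hf; apply: eq_recursive (rec_comp hh (g := fun=> f) (fun=> hf)) => v.
by congr h; apply: eq_from_tnth => i; rewrite tnth_mktuple (ord1 i).
Qed.

Lemma recursive_comp2 n (h : 2.-tuple nat -> nat) (f g : n.-tuple nat -> nat) :
  recursive h -> recursive f -> recursive g ->
  recursive (fun v => h [tuple f v; g v]).
Proof.
move=> hh hf hg.
have H i : recursive (tnth [tuple f; g] i).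
  by case: i => -[|[|//]] i; rewrite (tnth_nth f).
apply: eq_recursive (rec_comp hh H) => v; congr h.
apply: eq_from_tnth => i; rewrite tnth_mktuple.
by case: i => -[|[|//]] i; rewrite (tnth_nth f) (tnth_nth 0%N).
Qed.

Lemma recursive_comp3 n (h : 3.-tuple nat -> nat) (f g e : n.-tuple nat -> nat) :
  recursive h -> recursive f -> recursive g -> recursive e ->
  recursive (fun v => h [tuple f v; g v; e v]).
Proof.
move=> hh hf hg he.
have H i : recursive (tnth [tuple f; g; e] i).
  by case: i => -[|[|[|//]]] i; rewrite (tnth_nth f).
apply: eq_recursive (rec_comp hh H) => v; congr h.
apply: eq_from_tnth => i; rewrite tnth_mktuple.
by case: i => -[|[|[|//]]] i; rewrite (tnth_nth f) (tnth_nth 0%N).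
Qed.

(** Primitive recursion for a function [h] known only by its two recursion equations, so that no
    instance has to be matched with [nat_rect]. *)
Lemma recursive_rec n (f : n.-tuple nat -> nat) (g : n.+2.-tuple nat -> nat)
    (h : nat -> n.-tuple nat -> nat) :
    recursive f -> recursive g ->
    (forall v, h 0%N v = f v) ->
    (forall k v, h k.+1 v = g [tuple of k :: h k v :: v]) ->
  recursive (fun v : n.+1.-tuple nat => h (thead v) (behead_tuple v)).
Proof.
move=> hf hg h0 hS; apply: eq_recursive (rec_prim hf hg) => v.
by elim: (thead v) => [|k ih] /=; [rewrite h0 | rewrite hS ih].
Qed.

Lemma recursiveS n (f : n.-tuple nat -> nat) :
  recursive f -> recursive (fun v => (f v).+1).
Proof. by move=> /(recursive_comp1 rec_succ). Qed.

Lemma recursive_cst n k : recursive (fun _ : n.-tuple nat => k).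
Proof.
elim: k => [|k]; last exact: recursiveS.
have H (i : 'I_0) : recursive (fun _ : n.-tuple nat => 0%N) by case: i.
exact: eq_recursive (rec_comp rec_zero H).
Qed.

Lemma recursiveD n (f g : n.-tuple nat -> nat) :
  recursive f -> recursive g -> recursive (fun v => f v + g v)%N.
Proof.
(* In the step function, slot 0 holds the counter, slot 1 the previous value and slot 2 the first
   parameter. *)
move=> hf hg; have H := @recursive_rec 1 _ _ (fun k v => k + thead v)%N
  (rec_proj ord0) (recursiveS (rec_proj (inord 1))).
apply: (recursive_comp2 (H _ _) hf hg) => // k v.
by rewrite (tnth_nth 0%N) inordK.
Qed.

Lemma recursiveM n (f g : n.-tuple nat -> nat) :
  recursive f -> recursive g -> recursive (fun v => f v * g v)%N.
Proof.
move=> hf hg; have H := @recursive_rec 1 _ _ (fun k v => k * thead v)%N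
  (recursive_cst _ 0)
  (recursiveD (rec_proj (inord 2)) (rec_proj (inord 1))).
apply: (recursive_comp2 (H _ _) hf hg) => // k v.
by rewrite /thead !(tnth_nth 0%N) !inordK // mulSn.
Qed.

Lemma recursiveX n (f g : n.-tuple nat -> nat) :
  recursive f -> recursive g -> recursive (fun v => f v ^ g v)%N.
Proof.
move=> hf hg; have H := @recursive_rec 1 _ _ (fun k v => thead v ^ k)%N
  (recursive_cst _ 1)
  (recursiveM (rec_proj (inord 2)) (rec_proj (inord 1))).
apply: (recursive_comp2 (H _ _) hg hf) => // k v.
by rewrite /thead !(tnth_nth 0%N) !inordK // expnS.
Qed.

Lemma recursive_pred n (f : n.-tuple nat -> nat) :
  recursive f -> recursive (fun v => (f v).-1).
Proof.
have H := @recursive_rec 0 _ _ (fun k _ => k.-1) (recursive_cst _ 0)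
  (rec_proj ord0).
by move=> hf; apply: (recursive_comp1 (H _ _) hf).
Qed.

Lemma recursiveB n (f g : n.-tuple nat -> nat) :
  recursive f -> recursive g -> recursive (fun v => f v - g v)%N.
Proof.
move=> hf hg; have H := @recursive_rec 1 _ _ (fun k v => thead v - k)%N
  (rec_proj ord0) (recursive_pred (rec_proj (inord 1))).
apply: (recursive_comp2 (H _ _) hg hf) => [v|k v]; first by rewrite subn0.
by rewrite /thead !(tnth_nth 0%N) !inordK // subnS.
Qed.

Lemma recursive_leq n (f g : n.-tuple nat -> nat) :
  recursive f -> recursive g -> recursive (fun v => f v <= g v)%N.
Proof.
(* The truth value is the truncated difference [1 - (f v - g v)]. *)
move=> hf hg; apply: eq_recursive (recursiveB (recursive_cst _ 1)
  (recursiveB hf hg)) => v.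
by rewrite -[in RHS]subn_eq0; case: (f v - g v)%N => [|k]; rewrite ?subn0 ?subSS ?sub0n.
Qed.

Lemma recursive_eqn n (f g : n.-tuple nat -> nat) :
  recursive f -> recursive g -> recursive (fun v => f v == g v).
Proof.
move=> hf hg; apply: eq_recursive (recursiveM (recursive_leq hf hg)
  (recursive_leq hg hf)) => v.
by rewrite mulnb eqn_leq.
Qed.

Lemma recursive_rat_comp3 n (h : 3.-tuple nat -> rat)
    (f g e : n.-tuple nat -> nat) :
    recursive_rat h -> recursive f -> recursive g -> recursive e ->
  recursive_rat (fun v => h [tuple f v; g v; e v]).
Proof.
move=> [p [q [r [hp hq hr hE]]]] hf hg he.
exists (fun v => p [tuple f v; g v; e v]), (fun v => q [tuple f v; g v; e v]),
  (fun v => r [tuple f v; g v; e v]).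
by split; [exact: recursive_comp3..|move=> v; exact: hE].
Qed.

(** Cross-multiplying and moving the subtracted numerators to the other side leaves an inequality
    between natural numbers. *)
Lemma recursive_rat_le n (f g : n.-tuple nat -> rat) :
  recursive_rat f -> recursive_rat g -> recursive (fun v => f v <= g v).
Proof.
move=> [p [q [r [hp hq hr hE]]]] [p' [q' [r' [hp' hq' hr' hE']]]].
apply: (eq_recursive _ (recursive_leq
  (recursiveD (recursiveM hp (recursiveS hr')) (recursiveM hq' (recursiveS hr)))
  (recursiveD (recursiveM hp' (recursiveS hr)) (recursiveM hq (recursiveS hr'))))).
move=> v; rewrite hE hE' ler_pdivrMr ?ltr0n // mulrAC ler_pdivlMr ?ltr0n //.
rewrite -(ler_nat rat) !natrD !natrM !mulrBl.
by rewrite lerBlDr addrAC lerBrDr.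
Qed.

Lemma recursive_natr n (f : n.-tuple nat -> nat) :
  recursive f -> recursive_rat (fun v => (f v)%:R).
Proof.
move=> hf; exists f, (fun=> 0%N), (fun=> 0%N).
by split; [|exact: recursive_cst..|move=> v; rewrite subr0 divr1].
Qed.

(** * Codes of strings, and branches of the binary tree *)

(** The first symbol is the least significant digit, so an appended symbol has weight [2 ^ size x]:
    length and code determine the codes of both children. *)
Lemma str_code_rcons x b :
  str_code (rcons x b) = (str_code x + b.+1 * 2 ^ size x)%N.
Proof. by elim: x => [|c x ih] //=; rewrite ?ih ?expnS; lia. Qed.

Lemma str_code_inj : injective str_code.
Proof.
elim=> [|b x ih] [|c y] //=; try by lia.
move=> h; suff [-> /ih ->] : b = c /\ str_code x = str_code y by [].
by case: b c h => -[] /= h; split=> //; lia.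
Qed.

(** A path is coded by the rule [e] that picks the next symbol from the current string; the greedy
    path and the light paths below both have this form. *)
Definition branch (e : seq bool -> bool) (x : seq bool) (n : nat) : seq bool :=
  iter n (fun z => rcons z (e z)) x.

(** The string read here has length greater than [i], so the default [false] never shows. *)
Definition branch_limit (e : seq bool -> bool) (x : seq bool) (i : nat) : bool :=
  nth false (branch e x i.+1) i.

Lemma size_branch e x n : size (branch e x n) = (size x + n)%N.
Proof. by elim: n => [|n ih] /=; rewrite ?addn0 // size_rcons ih addnS. Qed.

Lemma prefix_branch e x m n :
  (m <= n)%N -> prefix (branch e x m) (branch e x n).
Proof.
move=> /subnK <-; elim: (n - m)%N => [|k ih] /=; first exact: prefix_refl.
exact: prefix_trans ih (prefix_rcons _ _).
Qed.

Lemma mkseq_branch_limit e x n :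
  mkseq (branch_limit e x) (size x + n) = branch e x n.
Proof.
have nthE m k i : (m <= k)%N -> (i < size x + m)%N ->
    nth false (branch e x m) i = nth false (branch e x k) i.
  move=> /(prefix_branch e x)/prefixP[t ->] im.
  by rewrite nth_cat size_branch im.
apply: (@eq_from_nth _ false); rewrite size_mkseq ?size_branch // => i im.
rewrite nth_mkseq // /branch_limit.
by case: (leqP i.+1 n) => h; [|symmetry]; apply: nthE => //; lia.
Qed.

(** A prefix-free set meets a branch at most once, which bounds the sums by 1. Stage [n] of the
    approximation reveals the prefixes of length less than [n]. *)
Lemma branch_semimeasure (R : realType) (e : seq bool -> bool) :
    recursive (fun v : 1.-tuple nat => str_code (branch e [::] (thead v))) ->
  lsc_semimeasure (fun x => (x == branch e [::] (size x))%:R : R).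
Proof.
set z := branch e [::] => hz.
have zE x k : (x == z k) = (size x == k) && (x == z (size x)).
  by apply/eqP/andP => [->|[/eqP <- /eqP//]]; rewrite size_branch !eqxx.
pose E (n c : nat) := has (fun k => c == str_code (z k)) (iota 0 n).
have EE n x : E n (str_code x) = (size x < n)%N && (x == z (size x)).
  apply/hasP/andP => [[k]|[xn /eqP xz]]; last first.
    by exists (size x); [rewrite mem_iota | rewrite -xz].
  by rewrite mem_iota add0n (inj_eq str_code_inj) zE => /= kn /andP[/eqP ->].
have recE : recursive (fun v : 2.-tuple nat => E (thead v) (thead (behead_tuple v))).
  (* The disjunction adding one more prefix to the test is [1 <= r + (c == code)]. *)
  have hE := recursive_leq (recursive_cst 3 1)
    (recursiveD (rec_proj (inord 1 : 'I_3))
      (recursive_eqn (rec_proj (inord 2)) (recursive_comp1 hz (rec_proj (inord 0))))).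
  apply: (@recursive_rec 1 _ _ (fun n v => E n (thead v)) (recursive_cst _ 0) hE).
    by [].
  move=> k v; rewrite /thead !(tnth_nth 0%N) !inordK //= /E -[X in iota _ X]addn1 iotaD has_cat /=.
  rewrite orbF add0n. by case: has; case: (_ == _).
split; first by move=> x; case: eqP.
- exists (fun n x => (E n (str_code x))%:R); split.
  + split.
      exists (fun v : 2.-tuple nat => (E (thead v) (thead (behead_tuple v)))%:R) => //.
      exact: recursive_natr.
    (* Codes do not decrease along the branch, so the code of [z n] bounds the support of stage
       [n]. *)
    exists (fun v : 1.-tuple nat => str_code (z (thead v))) => // n x xn.
    rewrite EE; case: ltnP => //= xn'; case: eqP => // xz.
    move: xn; rewrite {1}xz ltnNge => /negP[].
    have /prefixP[t] := prefix_branch e [::] (ltnW xn').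
    rewrite -/z => ->; elim/last_ind: t => [|t b ih]; first by rewrite cats0.
    by rewrite -rcons_cat str_code_rcons (leq_trans ih) // leq_addr.
  + move=> n x; rewrite !EE ler_nat ltnS.
    by case: (x == _); rewrite ?andbF ?andbT //; case: ltnP => // /ltnW ->.
  + move=> x; apply: cvg_near_cst; exists (size x).+1 => // n /= xn.
    by rewrite EE xn ratr_nat.
- move=> S pS; rewrite (_ : \esum_(x in S) _ =
      \esum_(x in S) if x \in [set x | x == z (size x)] then 1%E else 0%E); last first.
    apply: eq_esum => x _; case: ifPn => [/set_mem /= -> //|].
    by rewrite notin_setE /= => /negP/negbTE ->.
  rewrite -esum_mkcondr.
  have [->|] := eqVneq (S `&` [set x | x == z (size x)]) set0.
    by rewrite esum_set0 lee_fin ler01.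
  move=> /set0P[y [Sy /= /eqP yz]].
  rewrite (_ : _ `&` _ = [set y]) ?esum_set1 //.
  apply/seteqP; split=> [x [Sx /= /eqP xz]|x ->]; last by split=> //=; apply/eqP.
  have [xy|/ltnW xy] := leqP (size x) (size y).
    by apply: pS => //; rewrite xz yz prefix_branch.
  by symmetry; apply: pS => //; rewrite xz yz prefix_branch.
Qed.

(** * Measures of cylinders, and the greedy branch *)

Section Mass.
Context (R : realType) (mu : probability Omega R).

Definition mass (x : seq bool) : R := fine (mu (cylinder x)).

Lemma measurable_cylinder x : measurable (cylinder x : set Omega).
Proof. by apply: sub_sigma_algebra; exists x. Qed.

Lemma massE x : mu (cylinder x) = (mass x)%:E.
Proof. by rewrite fineK // fin_num_measure //; exact: measurable_cylinder. Qed.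

Lemma mass_ge0 x : 0 <= mass x.
Proof. by rewrite -lee_fin -massE. Qed.

Lemma mass_nil : mass [::] = 1.
Proof.
rewrite /mass (_ : cylinder _ = setT) ?probability_setT //.
by apply/seteqP; split.
Qed.

Lemma mass_split x b : mass x = mass (rcons x b) + mass (rcons x (~~ b)).
Proof.
have cyl c (w : Omega) :
    cylinder (rcons x c) w <-> cylinder x w /\ w (size x) = c.
  rewrite /cylinder /= size_rcons mkseqS; split=> [/rcons_inj[-> ->] //|[-> ->] //].
apply: EFin_inj; rewrite EFinD -!massE -measureU; [|exact: measurable_cylinder..|].
- congr (mu _); apply/seteqP; split=> [w xw|w [|] /cyl[]//].
  have [wb|wb] := eqVneq (w (size x)) b; [left|right]; apply/cyl; split=> //.
  by move: wb; case: b; case: (w _).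
- apply/seteqP; split=> // w [] /cyl[_ wb] /cyl[_].
  by rewrite wb; case: b {wb}.
Qed.

Lemma mass_rcons x b : mass (rcons x b) <= mass x.
Proof. by rewrite (mass_split x b) lerDl mass_ge0. Qed.

Lemma mass_prefix x y : prefix x y -> mass y <= mass x.
Proof.
move=> /prefixP[t ->]; elim/last_ind: t => [|t b ih]; first by rewrite cats0.
by rewrite -rcons_cat (le_trans (mass_rcons _ _)).
Qed.

(** The cylinders along a branch decrease to a single sequence, which is null; continuity from above
    applies. *)
Lemma mass_branch_cvg0 e x (eps : R) : non_atomic mu -> 0 < eps ->
  exists N, forall n, (N <= n)%N -> mass (branch e x n) < eps.
Proof.
move=> na eps0; pose F n : set Omega := cylinder (branch e x n).
have FE n w : F n w -> mkseq w (size x + n) = branch e x n.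
  by rewrite /F /cylinder /= size_branch.
have F1 : \bigcap_n F n = [set branch_limit e x : Omega].
  apply/seteqP; split=> [w Fw /=|w -> n _].
    apply/funext => i; have /FE h := Fw i.+1 I.
    have := congr1 (fun s => nth false s i) h.
    by rewrite nth_mkseq //; lia.
  by rewrite /F /cylinder /= size_branch mkseq_branch_limit.
have mF n : measurable (F n) by exact: measurable_cylinder.
have : mu \o F @ \oo --> mu (\bigcap_n F n).
  apply: nonincreasing_cvg_mu => //.
  - by rewrite -ge0_fin_numE // fin_num_measure.
  - exact: bigcapT_measurable.
  - move=> n k nk; apply/subsetPset => w; rewrite /F /cylinder /= => wk.
    move/prefixP: (prefix_branch e x nk) => [t tE].
    have := congr1 (take (size (branch e x n))) wk.
    rewrite tE take_size_cat // => {2}<-.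
    by rewrite size_cat /mkseq -map_take take_iota (minn_idPl (leq_addr _ _)).
rewrite F1 na => /fine_cvgP[_] /cvgrPdist_lt /(_ _ eps0)[N _ h].
by exists N => n /h; rewrite /= sub0r normrN ger0_norm // mass_ge0.
Qed.

Context (F : 3.-tuple nat -> rat).

(** Comparing the exact masses of the children is not computable in general, so approximations with
    error below [4 ^- (size x).+1] are compared instead. *)
Definition greedy (x : seq bool) : bool :=
  F [tuple str_code (rcons x false); 0%N; (4 ^ (size x).+1)%N] <=
  F [tuple str_code (rcons x true); 0%N; (4 ^ (size x).+1)%N].

(** The counter is the length of the current prefix, so counter and code suffice to compute the
    children, the precision and the next code. *)
Lemma recursive_greedy : recursive_rat F ->
  recursive (fun v : 1.-tuple nat => str_code (branch greedy [::] (thead v))).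
Proof.
move=> hF.
have k_rec := rec_proj (ord0 : 'I_2); have r_rec := rec_proj (ord_max : 'I_2).
have child b := recursiveD r_rec
  (recursiveM (recursive_cst 2 b.+1) (recursiveX (recursive_cst 2 2) k_rec)).
have approx b := recursive_rat_comp3 hF (child b) (recursive_cst 2 0)
  (recursiveX (recursive_cst 2 4) (recursiveS k_rec)).
have step := recursiveD r_rec (recursiveM
  (recursiveS (recursive_rat_le (approx false) (approx true)))
  (recursiveX (recursive_cst 2 2) k_rec)).
apply: (@recursive_rec 0 _ _ (fun k _ => str_code (branch greedy [::] k))
  (recursive_cst 0 0) step) => // k v.
rewrite /= str_code_rcons size_branch add0n !(tnth_nth 0%N) /=.
by rewrite /greedy !str_code_rcons size_branch add0n.
Qed.

Context (F_approx : forall (x : seq bool) (p q : nat),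
  (`|mu (cylinder x) - (ratr (F [tuple str_code x; p; q]))%:E|
        <= (p.+1%:R / q.+1%:R)%:E)%E).

(** The invariant [4 ^- n <= mass] makes each approximation error at most a quarter of the current
    mass. The child that looks larger then falls short of its sibling by at most half of that mass,
    hence keeps at least a quarter, which preserves the invariant. *)
Lemma greedy_mass n : mass (branch greedy [::] n) > 0 /\
  mass (branch greedy [::] n) <= 4 * mass (branch greedy [::] n.+1).
Proof.
set z := branch greedy [::].
have step k : 4 ^- k <= mass (z k) -> mass (z k) <= 4 * mass (z k.+1).
  move=> zk; rewrite /z /= -/(z k); set x := z k.
  have apx b : `|mass (rcons x b) -
      ratr (F [tuple str_code (rcons x b); 0%N; (4 ^ k.+1)%N])| <= mass x / 4.
    have := F_approx (rcons x b) 0 (4 ^ k.+1); rewrite massE -EFinB abse_EFin lee_fin.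
    move=> /le_trans; apply; rewrite div1r.
    apply: (@le_trans _ _ (4 ^- k.+1)); last by rewrite exprSr invfM ler_pM2r.
    by rewrite lef_pV2 ?posrE ?exprn_gt0 // -natrX ler_nat.
  have sz : size x = k by rewrite size_branch.
  have m0 : 0 <= mass x by exact: mass_ge0.
  have := mass_split x true; have := apx true; have := apx false.
  rewrite /= !ler_norml /greedy sz.
  case: (leP (F _)) => h /andP[h1 h2] /andP[h3 h4] h5.
    have : ratr (F [tuple str_code (rcons x false); 0%N; (4 ^ k.+1)%N]) <=
      ratr (F [tuple str_code (rcons x true); 0%N; (4 ^ k.+1)%N]) :> R.
      by rewrite ler_rat.
    move: h1 h2 h3 h4 h5; set u := ratr _; set v := ratr _; lra.
  have : ratr (F [tuple str_code (rcons x true); 0%N; (4 ^ k.+1)%N]) <=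
      ratr (F [tuple str_code (rcons x false); 0%N; (4 ^ k.+1)%N]) :> R.
    by rewrite ler_rat ltW.
  move: h1 h2 h3 h4 h5; set u := ratr _; set v := ratr _; lra.
have lb k : 4 ^- k <= mass (z k).
  elim: k => [|k ih]; first by rewrite mass_nil expr0 invr1.
  by rewrite exprSr invfM ler_pdivrMr // mulrC (le_trans ih) // step.
by split; [apply: lt_le_trans (lb n) | exact: step].
Qed.

End Mass.

(** * Finite antichains carrying much of the semimeasure *)

Section Heavy.
Context (R : realType) (a : seq bool -> R).

(** Lower bounds on what [a] collects on antichains below [x]. Finite lists as witnesses can be
    concatenated, and they carry the compactness argument. *)
Definition heavy (x : seq bool) (r : R) : Prop :=
  exists s : seq (seq bool),
    [/\ uniq s, {in s, forall y, prefix x y},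
        {in s &, forall y z, prefix y z -> y = z} & r <= \sum_(y <- s) a y].

Lemma heavy_le x r r' : r <= r' -> heavy x r' -> heavy x r.
Proof.
by move=> rr' [s [us xs ps ss]]; exists s; split=> //; exact: le_trans ss.
Qed.

Lemma heavy0 x : heavy x 0.
Proof. by exists [::]; split; rewrite ?big_nil. Qed.

Lemma heavy_refl x : heavy x (a x).
Proof.
exists [:: x]; split=> //; rewrite ?big_seq1 //.
  by move=> y; rewrite inE => /eqP ->; exact: prefix_refl.
by move=> y z; rewrite !inE => /eqP -> /eqP ->.
Qed.

Lemma prefix_rcons_disjoint x b y :
  prefix (rcons x b) y -> prefix (rcons x (~~ b)) y = false.
Proof.
move=> /prefixP[t ->]; apply/negP => /prefixP[t'].
rewrite -!cats1 -!catA => /eqP; rewrite eqseq_cat // eqxx /= eqseq_cons.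
by case: b.
Qed.

(** Extensions of different children are incomparable, so the two antichains together form one. *)
Lemma heavyD x b r r' :
  heavy (rcons x b) r -> heavy (rcons x (~~ b)) r' -> heavy x (r + r').
Proof.
move=> [s [us xs ps ss]] [s' [us' xs' ps' ss']].
have xb c y : prefix (rcons x c) y -> prefix x y.
  exact/prefix_trans/prefix_rcons.
have dis y z : y \in s -> z \in s' -> prefix y z || prefix z y -> False.
  move=> /xs ys /xs' zs /orP[yz|zy].
    by have := prefix_rcons_disjoint (prefix_trans ys yz); rewrite zs.
  have := prefix_rcons_disjoint ys.
  by rewrite (prefix_trans zs zy).
exists (s ++ s'); split.
- rewrite cat_uniq us us' andbT /=; apply/hasPn => y ys'.
  by apply/negP => ys; apply: dis ys ys' _; rewrite prefix_refl.
- by move=> y; rewrite mem_cat => /orP[/xs|/xs'] /xb.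
- move=> y z; rewrite !mem_cat => /orP[ys|ys] /orP[zs|zs] yz.
  + exact: ps.
  + by case: (dis y z); rewrite ?yz.
  + by case: (dis z y); rewrite ?yz ?orbT.
  + exact: ps'.
- by rewrite big_cat lerD.
Qed.

Lemma heavy_le1 x r : lsc_semimeasure a -> heavy x r -> r <= 1.
Proof.
move=> [a0 _ a1] [s [us _ ps]] /le_trans; apply.
have := a1 [set` s] (fun y z ys zs => ps y z ys zs).
rewrite esum_fset; [|exact: finite_seq|by move=> y _; rewrite lee_fin].
by rewrite -fsbig_seq // sumEFin lee_fin.
Qed.

(* Contrapositive of compactness: if the inequality held at some prefix of
   every branch through [x], finitely many prefixes would cover [x]. *)
Lemma light_branch (m : seq bool -> R) (F : R) x :
    (forall y b, m y = m (rcons y b) + m (rcons y (~~ b))) ->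
    ~ heavy x (F * m x) ->
  exists e, forall n, a (branch e x n) < F * m (branch e x n).
Proof.
(* [e] goes right exactly when the left child is heavy. Two heavy children would make their parent
   heavy, so the path never enters a heavy string. *)
move=> mD hx; pose e y := `[< heavy (rcons y false) (F * m (rcons y false)) >].
exists e => n; set y := branch e x n.
have : ~ heavy y (F * m y).
  rewrite /y; elim: n {y} => //= n ih; set y := branch e x n.
  rewrite /e; case: asboolP => // h h'; apply: ih.
  by rewrite (mD _ false) mulrDr; exact: (heavyD (b := false)) h h'.
move=> hy; rewrite ltNge; apply/negP => /heavy_le h; apply: hy; apply: h.
exact: heavy_refl.
Qed.

End Heavy.

(** * Estimates for logarithms *)

Section Log2.
Context (R : realType).
Implicit Types x y : R.

Lemma ln2_gt0 : 0 < ln 2 :> R.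
Proof. by rewrite ln_gt0 // ltr1n. Qed.

Lemma log2_div x y : 0 < x -> 0 < y -> log2 (x / y) = log2 x - log2 y.
Proof. by move=> x0 y0; rewrite /log2 ln_div ?posrE // mulrBl. Qed.

Lemma ler_log2 x y : 0 < x -> x <= y -> log2 x <= log2 y.
Proof.
move=> x0 xy; rewrite ler_pM2r ?invr_gt0 ?ln2_gt0 // ler_ln // posrE //.
exact: lt_le_trans xy.
Qed.

Lemma ln_le_subr1 x : 0 < x -> ln x <= x - 1.
Proof. by move=> x0; rewrite -{1}(subrKC 1 x) le_ln1Dx //; lra. Qed.

(** The derivative [1 - 1 / (t * ln 2)] is nonnegative from [(ln 2)^-1] on; the proof gets by with
    [ln t <= t - 1] at [t = y / x]. *)
Lemma sub_log2_mono x y : (ln 2)^-1 <= x -> x <= y ->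
  x - log2 x <= y - log2 y.
Proof.
move=> x2 xy; have x0 : 0 < x by apply: lt_le_trans x2; rewrite invr_gt0 ln2_gt0.
have y0 : 0 < y by exact: lt_le_trans xy.
suff : log2 y - log2 x <= y - x by lra.
rewrite -log2_div // /log2 ler_pdivrMr ?ln2_gt0 //.
apply: le_trans (ln_le_subr1 (divr_gt0 y0 x0)) _.
rewrite -[X in _ - X](divff (lt0r_neq0 x0)) -mulrBl ler_wpM2l ?subr_ge0 //.
by rewrite invf_ple ?posrE // ln2_gt0.
Qed.

End Log2.

(** * From bounds on [a] to bounds on deficiencies *)

Section Deficiency.
Context (R : realType) (mu : probability Omega R) (a : seq bool -> R).
Implicit Types (w : Omega) (D F c : R).

Lemma deficiencyE w k :
    0 < mass mu (mkseq w k) -> 0 < a (mkseq w k) ->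
  deficiency mu a w k = (log2 (a (mkseq w k)) - log2 (mass mu (mkseq w k)))%:E.
Proof.
move=> m0 a0; rewrite /deficiency /KA /log2e massE !lne_EFin //.
by rewrite -!EFinM -!EFinN -EFinD opprK addrC.
Qed.

Lemma deficiency_ge w k D : 0 < D -> 0 < mass mu (mkseq w k) ->
  D * mass mu (mkseq w k) <= a (mkseq w k) -> ((log2 D)%:E <= deficiency mu a w k)%E.
Proof.
move=> D0 m0 Da; have a0 := lt_le_trans (mulr_gt0 D0 m0) Da.
rewrite deficiencyE // lee_fin -log2_div //.
by rewrite ler_log2 // ler_pdivlMr.
Qed.

Lemma deficiency_le w k F : 0 < mass mu (mkseq w k) -> 0 <= a (mkseq w k) ->
  a (mkseq w k) <= F * mass mu (mkseq w k) -> (deficiency mu a w k <= (log2 F)%:E)%E.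
Proof.
(* Where [a] vanishes, [KA] is [+oo] and the deficiency is [-oo]. *)
move=> m0; rewrite le_eqVlt => /predU1P[a0 _|a0 aF].
  rewrite /deficiency /KA /log2e massE lne_EFin // -a0 le0_lneNy //.
  rewrite gt0_mulNye ?lte_fin ?invr_gt0 ?ln2_gt0 //.
  by rewrite -EFinM -EFinN leNye.
rewrite deficiencyE // lee_fin -log2_div //.
by rewrite ler_log2 ?divr_gt0 // ler_pdivrMr.
Qed.

(** The prefix of length [n] gives [dA >= log2 D], and the tail from [N] on gives
    [dlimsupA <= log2 F]. Monotonicity of [t - log2 t] lets [dA] replace [log2 D] in the gap. *)
Lemma deficiency_gap w c D F n N :
    (forall x, 0 <= a x <= 1) ->
    0 < D -> 0 < F -> 0 < mass mu (mkseq w n) ->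
    D * mass mu (mkseq w n) <= a (mkseq w n) ->
    (forall k, (N <= k)%N -> a (mkseq w k) < F * mass mu (mkseq w k)) ->
    (ln 2)^-1 <= log2 D -> log2 F < log2 D - log2 (log2 D) - c ->
  exists d : R, [/\ 0 < d, dA mu a w = d%:E &
    (dlimsupA mu a w < (d - log2 d - c)%:E)%E].
Proof.
move=> a01 D0 F0 mn Dn FN D2 FD.
have a0 x : 0 <= a x by case/andP: (a01 x).
(* As [a] is nonnegative, the strict bound forces positive mass. *)
have mN k : (N <= k)%N -> 0 < mass mu (mkseq w k).
  move=> /FN /(le_lt_trans (a0 _)); by rewrite pmulr_rgt0.
have mkP i k : (i <= k)%N -> prefix (mkseq w i) (mkseq w k).
  move=> ik; apply/prefixP; exists (map w (iota i (k - i))).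
  by rewrite -map_cat -[X in iota X (k - i)]add0n -iotaD subnKC.
have mpos k : 0 < mass mu (mkseq w k).
  by apply: lt_le_trans (mN (maxn k N) (leq_maxr _ _)) _;
    rewrite mass_prefix // mkP // leq_maxl.
(* [F] bounds the ratio of [a] to mass from [N] on; before [N], [a <= 1] and the mass is at least
   that at [N]. Hence [dA] is finite. *)
pose G := Num.max F (mass mu (mkseq w N))^-1.
have ubG k : (deficiency mu a w k <= (log2 G)%:E)%E.
  apply: deficiency_le => //; have [Nk|kN] := leqP N k.
    apply: le_trans (ltW (FN _ Nk)) _.
    by rewrite ler_pM2r // le_max lexx.
  have /andP[_ /le_trans] := a01 (mkseq w k); apply.
  rewrite -ler_pdivrMr // div1r le_max; apply/orP; right.
  by rewrite lef_pV2 ?posrE // mass_prefix // mkP // ltnW.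
have supG : (dA mu a w <= (log2 G)%:E)%E by apply: ge_ereal_sup => _ [k _ <-].
have supD : ((log2 D)%:E <= dA mu a w)%E.
  apply: le_trans (deficiency_ge D0 mn Dn) _.
  by apply: ereal_sup_ubound; exists n.
have /fineK dE : dA mu a w \is a fin_num.
  by rewrite fin_numElt (lt_le_trans (ltNyr _) supD) (le_lt_trans supG (ltry _)).
set d := fine _ in dE; have Dd : log2 D <= d by rewrite -lee_fin dE.
exists d; split=> //.
  by apply: lt_le_trans Dd; apply: lt_le_trans D2; rewrite invr_gt0 ln2_gt0.
apply: (@le_lt_trans _ _ (log2 F)%:E); last first.
  by rewrite lte_fin (lt_le_trans FD) // lerB // sub_log2_mono.
apply: (@le_trans _ _ (ereal_sup (deficiency mu a w @` [set k | (N <= k)%N]))).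
  by apply: ereal_inf_lbound => /=; exists [set k | (N <= k)%N] => //; exists N.
apply: ge_ereal_sup => _ [k /= Nk <-].
by apply: deficiency_le => //; exact/ltW/FN.
Qed.

End Deficiency.

(** * Divergence of the mass collected beside the greedy branch *)

Theorem theorem1 (R : realType) (mu : probability Omega R)
  (mu_computable : computable_measure mu) (mu_non_atomic : non_atomic mu)
  (a : seq bool -> R) (a_universal : universal_semimeasure a) (c : R) :
  exists (w : Omega) (d : R),
    [/\ 0 < d, dA mu a w = d%:E &
        (dlimsupA mu a w < (d - log2 d - c)%:E)%E].
Proof.
have [G hG G_approx] := mu_computable.
have [a_lsc a_max] := a_universal; have [a0 _ _] := a_lsc.
pose z := branch (greedy G) [::]; pose m := mass mu.
have z_pos n : 0 < m (z n) by case: (greedy_mass G_approx n).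
have z_ratio n : m (z n) <= 4 * m (z n.+1) by case: (greedy_mass G_approx n).
have [C bC] := a_max _ (branch_semimeasure R (recursive_greedy hG)).
have aC n : 1 <= C * a (z n).
  by apply: le_trans (bC (z n)); rewrite size_branch eqxx.
have C0 : 0 < C.
  rewrite ltNge; apply/negP => Cle0; have := aC 0%N.
  by rewrite leNgt (le_lt_trans _ ltr01) // mulr_le0_ge0.
have a01 x : 0 <= a x <= 1.
  by rewrite a0 /=; exact: heavy_le1 a_lsc (heavy_refl a x).
apply: contrapT => noW.
pose D n := (C * m (z n))^-1; pose l n := log2 (D n).
have D0 n : 0 < D n by rewrite invr_gt0 mulr_gt0.
have l_big T : exists N, forall n, (N <= n)%N -> T <= l n.
  (* [expR (T * ln 2)] is 2 to the power [T]: mass below this threshold means [l n >= T]. *)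
  have e0 : 0 < (C * expR (T * ln 2))^-1 by rewrite invr_gt0 mulr_gt0 ?expR_gt0.
  have [N NP] := mass_branch_cvg0 (greedy G) [::] mu_non_atomic e0.
  exists N => n /NP /ltW; rewrite -/(m _) => mn.
  rewrite ler_pdivlMr ?ln2_gt0 // -[leLHS]expRK ler_ln ?posrE ?expR_gt0 //.
  rewrite /D -[leLHS]invrK lef_pV2 ?posrE ?invr_gt0 ?mulr_gt0 ?expR_gt0 //.
  by rewrite -ler_pdivlMl // -invfM.
have ln20 := ln2_gt0 R.
(* [K] is 2 to the power [c + 1]; the extra 1 makes the inequality for [log2 (F n)] strict. *)
pose K := expR ((c + 1) * ln 2); have K0 : 0 < K by exact: expR_gt0.
pose F n := D n / (l n * K).
pose sib n := rcons (z n) (~~ greedy G (z n)).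
have sib_heavy n : (ln 2)^-1 <= l n -> heavy a (sib n) (F n * m (sib n)).
  move=> ln_ge; apply: contrapT.
  move=> /(light_branch (fun y b => mass_split mu y b))[e light].
  have l0 : 0 < l n by apply: lt_le_trans ln_ge; rewrite invr_gt0.
  (* The sibling has length [n.+1], so the light bound holds from that length on; one symbol less
     gives [z n], where the deficiency is large. *)
  have wE k : mkseq (branch_limit e (sib n)) (n.+1 + k) = branch e (sib n) k.
    by rewrite -mkseq_branch_limit size_rcons size_branch.
  have wn : mkseq (branch_limit e (sib n)) n = z n.
    have := wE 0%N; rewrite addn0 mkseqS => /rcons_inj[-> _] //.
  apply: noW; exists (branch_limit e (sib n) : Omega).
  apply: (deficiency_gap (D := D n) (F := F n) (n := n) (N := n.+1)) => //.
  - by rewrite divr_gt0 // mulr_gt0.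
  - by rewrite wn.
  - rewrite wn /D invfM -mulrA mulVf ?gt_eqF // mulr1.
    by rewrite -div1r ler_pdivrMr // mulrC.
  - by move=> k /subnKC <-; rewrite wE.
  - rewrite /F log2_div ?(mulr_gt0 l0 K0) // -/(l n) [log2 (_ * _)]/log2.
    by rewrite lnM ?posrE // expRK mulrDl mulfK ?gt_eqF // -/(log2 (l n)); lra.
(* The 4 is the greedy mass ratio, [C] and [K] come from [F n], and [ln 2] converts the binary
   logarithm in [l]. *)
pose kappa := ln 2 / (4 * C * K).
have kappa0 : 0 < kappa by rewrite divr_gt0 // !mulr_gt0.
have [n0 n0P] := l_big (ln 2)^-1.
have l0 n : (n0 <= n)%N -> 0 < l n.
  by move=> /n0P; apply: lt_le_trans; rewrite invr_gt0.
have step n : (n0 <= n)%N -> kappa * (ln (l n.+1) - ln (l n)) <= F n * m (sib n).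
  move=> nn; have ln0 := l0 n nn; have lS0 := l0 n.+1 (leqW nn).
  have mE : m (sib n) = m (z n) - m (z n.+1).
    by rewrite /m (mass_split mu (z n) (greedy G (z n))) addrC addKr.
  (* [ln t <= t - 1] at the ratio of successive masses; [lnE] uses the same bound at the ratio of
     successive values of [l]. *)
  have lE : (l n.+1 - l n) * ln 2 <= m (sib n) / m (z n.+1).
    rewrite -(log2_div (D0 n.+1) (D0 n)) divfK ?gt_eqF // mE mulrBl divff ?gt_eqF //.
    have -> : D n.+1 / D n = m (z n) / m (z n.+1).
      by rewrite /D; field; rewrite !gt_eqF.
    exact/ln_le_subr1/divr_gt0.
  have lnE : ln (l n.+1) - ln (l n) <= (l n.+1 - l n) / l n.
    rewrite -ln_div ?posrE //.
    apply: le_trans (ln_le_subr1 (divr_gt0 lS0 ln0)) _.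
    by rewrite mulrBl divff ?gt_eqF.
  have sib0 : 0 <= m (sib n) by exact: mass_ge0.
  apply: le_trans (ler_wpM2l (ltW kappa0) lnE) _.
  have -> : kappa * ((l n.+1 - l n) / l n) =
      (l n.+1 - l n) * ln 2 / (4 * C * K * l n).
    by rewrite /kappa; field; rewrite !gt_eqF.
  have den0 : 0 < 4 * C * K * l n by apply: mulr_gt0 ln0; rewrite !mulr_gt0.
  rewrite ler_pdivrMr //; apply: le_trans lE _.
  have -> : F n * m (sib n) * (4 * C * K * l n) = 4 * (m (sib n) / m (z n)).
    by rewrite /F /D; field; rewrite !gt_eqF.
  rewrite mulrCA ler_wpM2l // -[leLHS]div1r ler_pdivrMr // mulrAC.
  by rewrite ler_pdivlMr // mul1r.
(* Each step splits [z n] into [z n.+1], covered by induction, and [sib n]; the logarithms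
   telescope. *)
have tele j n : (n0 <= n)%N -> heavy a (z n) (kappa * (ln (l (n + j)%N) - ln (l n))).
  elim: j n => [|j ih] n nn; first by rewrite addn0 subrr mulr0; exact: heavy0.
  have := heavyD (ih n.+1 (leqW nn)) (sib_heavy n (n0P n nn)).
  apply: heavy_le; rewrite addSnnS.
  have := step n nn; lra.
(* This threshold raises [ln (l n0)] by [2 / kappa], so [z n0] would carry mass 2. *)
have [N NP] := l_big (l n0 * expR (2 / kappa)).
have := heavy_le1 a_lsc (tele N n0 (leqnn _)).
have := NP _ (leq_addl n0 N).
have l00 := l0 n0 (leqnn _); have lN0 := l0 _ (leq_addr N n0).
have T0 := mulr_gt0 l00 (expR_gt0 (2 / kappa)).
rewrite -ler_ln ?posrE //.
rewrite lnM ?posrE ?expR_gt0 // expRK -lerBrDl ler_pdivrMr // => h1 h2.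
have : 2 <= 1 :> R by apply: le_trans h1 _; rewrite mulrC.
by rewrite leNgt ltr1n.
Qed.
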